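(* Let $S$ be an inverse semigroup. For each McAlister function $p \colon I \times I \rightarrow S$, the inverse Rees matrix semigroup $IM(S,I,p)$ is Morita equivalent to $S$; and every inverse semigroup Morita equivalent to $S$ is isomorphic to $IM(S,I,p)$ for some set $I$ and some McAlister function $p \colon I \times I \rightarrow S$.
   Context: For an inverse semigroup $S$, $E(S)$ denotes its set of idempotents and $\leq$ its natural partial order. Morita equivalence: a left action of $S$ on a set $X$ is unitary if $SX = X$. $S$-$\mathbf{mod}$ is the category of unitary left $S$-sets and left $S$-homomorphisms. Inverse semigroups $S$ and $T$ are Morita equivalent if the categories $S$-$\mathbf{mod}$ and $T$-$\mathbf{mod}$ are equivalent. McAlister function: a function $p \colon I \times I \to S$, $(i,j) \mapsto p_{i,j}$, where $I$ is a set, such that for all $i,j,k \in I$: (MF1) $p_{i,i}$ is an idempotent; (MF2) $p_{i,i}p_{i,j}p_{j,j} = p_{i,j}$; (MF3) $p_{i,j} = p_{j,i}^{-1}$; (MF4) $p_{i,j}p_{j,k} \leq p_{i,k}$; and (MF5) for each $e \in E(S)$ there exists $i \in I$ such that $e \leq p_{i,i}$. Rees matrix semigroups: $M(S,I,p)$ is the set $I \times S \times I$ with multiplication $(i,s,j)(k,t,l) = (i, s p_{j,k} t, l)$. $RM(S,I,p)$ denotes the set of (von Neumann) regular elements of $M(S,I,p)$; it is a regular semigroup. For a regular semigroup $R$, $\gamma$ denotes the minimum inverse congruence on $R$, i.e. the intersection of all congruences $\rho$ on $R$ such that $R/\rho$ is inverse. The inverse Rees matrix semigroup is $IM(S,I,p)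 = RM(S,I,p)/\gamma$. *)

(* Defs.v *)
From HB Require Import structures.
From mathcomp Require Import all_boot.
From mathcomp Require Import boolp.

Set Implicit Arguments.
Unset Strict Implicit.
Unset Printing Implicit Defensive.

Local Open Scope group_scope.
Local Open Scope quotient_scope.

Definition idempotent_elt (S : semigroupType) (e : S) : Prop := e * e = e.

Definition regular_elt (S : semigroupType) (x : S) : Prop :=
  exists y : S, x * y * x = x.

Definition regular_semigroup (S : semigroupType) : Prop :=
  forall x : S, regular_elt x.

Definition is_inverse_of (S : semigroupType) (x y : S) : Prop :=
  x * y * x = x /\ y * x * y = y.

Definition inverse_semigroup (S : semigroupType) : Prop :=
  forall x : S, exists! y : S, is_inverse_of x y.

Lemma is_inverse_of_regular (S : semigroupType) (x y : S) :
  x * y * x = x -> is_inverse_of x (y * x * y).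
Proof.
move=> xyx; split; first by rewrite !mulgA !xyx.
by rewrite -!mulgA (mulgA x y) (mulgA (x * y) x) xyx (mulgA x y (x * y))
           (mulgA (x * y) x) xyx.
Qed.

HB.mixin Record Semigroup_isInverse S of Semigroup S := {
  inverse_semigroupP : inverse_semigroup S
}.

#[short(type="invSemigroupType")]
HB.structure Definition InvSemigroup :=
  { S of Semigroup S & Semigroup_isInverse S }.

(* The library notation x^-1 requires a unit, hence a separate operation. *)
Definition sinv (S : invSemigroupType) (x : S) : S :=
  sval (cid (inverse_semigroupP x)).

Lemma sinvP (S : invSemigroupType) (x : S) : is_inverse_of x (sinv x).
Proof. by rewrite /sinv; case: cid => y []. Qed.

Definition natural_le (S : invSemigroupType) (s t : S) : Prop :=
  exists e : S, idempotent_elt e /\ s = t * e.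

Lemma inverse_regular (S : invSemigroupType) : regular_semigroup S.
Proof. by move=> x; exists (sinv x); case: (sinvP x). Qed.

Record congruence (R : semigroupType) := Congruence {
  cong_rel :> equiv_rel R;
  congM : forall x x' y y' : R,
    cong_rel x x' -> cong_rel y y' -> cong_rel (x * y) (x' * y')
}.

Definition quot (R : semigroupType) (rho : congruence R) : Type :=
  {eq_quot rho}.

Section Quot.
Variables (R : semigroupType) (rho : congruence R).

HB.instance Definition _ := Choice.on (quot rho).
HB.instance Definition _ := EqQuotient.on (quot rho).

Definition quot_mul : quot rho -> quot rho -> quot rho :=
  lift_op2 (quot rho) (@mul R).

Lemma quot_eqP (x y : R) : (x = y %[mod quot rho]) <-> rho x y.
Proof. by split=> [/eqmodP | ? ]; last exact/eqmodP. Qed.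

Lemma quot_mul_pi (x y : R) :
  quot_mul (\pi x) (\pi y) = \pi_(quot rho) (x * y).
Proof.
by unlock quot_mul; apply/quot_eqP/congM; apply/quot_eqP; rewrite reprK.
Qed.

Lemma quot_mulA : associative quot_mul.
Proof.
move=> a b c; rewrite -[a]reprK -[b]reprK -[c]reprK.
by rewrite !quot_mul_pi mulgA.
Qed.

HB.instance Definition _ := isSemigroup.Build (quot rho) quot_mulA.

Lemma piM (x y : R) : \pi_(quot rho) (x * y) = \pi_(quot rho) x * \pi_(quot rho) y.
Proof. by rewrite -quot_mul_pi. Qed.

End Quot.

Section Gamma.
Variable R : semigroupType.

Definition gamma_rel : rel R := fun x y =>
  `[< forall rho : congruence R, inverse_semigroup (quot rho) -> rho x y >].

Lemma gamma_refl : reflexive gamma_rel.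
Proof. by move=> x; apply/asboolP => rho _; apply: equiv_refl. Qed.

Lemma gamma_sym : symmetric gamma_rel.
Proof.
by move=> x y; apply/asboolP/asboolP => xy rho /xy; rewrite equiv_sym.
Qed.

Lemma gamma_trans : transitive gamma_rel.
Proof.
move=> y x z /asboolP xy /asboolP yz; apply/asboolP => rho inv.
exact: equiv_trans (xy _ inv) (yz _ inv).
Qed.

Lemma gammaM (x x' y y' : R) :
  gamma_rel x x' -> gamma_rel y y' -> gamma_rel (x * y) (x' * y').
Proof.
move=> /asboolP xx /asboolP yy; apply/asboolP => rho inv.
exact: congM (xx _ inv) (yy _ inv).
Qed.

Definition gamma : congruence R :=
  @Congruence R (EquivRel gamma_rel gamma_refl gamma_sym gamma_trans) gammaM.

Lemma gamma_inverse : regular_semigroup R -> inverse_semigroup (quot gamma).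
Proof.
move=> reg a; rewrite -[a]reprK; set x := repr a.
have inv_pi (rho : congruence R) u v :
    is_inverse_of (\pi_(quot rho) u) (\pi_(quot rho) v)
    <-> rho (u * v * u) u /\ rho (v * u * v) v.
  by rewrite /is_inverse_of -!piM; split=> -[? ?]; split; apply/quot_eqP.
have [y /is_inverse_of_regular[xz zx]] := reg x.
exists (\pi_(quot gamma) (y * x * y)); split.
  by apply/inv_pi; rewrite xz zx; split; apply: equiv_refl.
move=> b; rewrite -[b]reprK => /inv_pi[/asboolP xb /asboolP bx].
apply/quot_eqP/asboolP => rho inv; have [w [_ uniq_w]] := inv (\pi_(quot rho) x).
apply/quot_eqP; rewrite -(uniq_w (\pi_(quot rho) (repr b))).
  by apply/esym/uniq_w/inv_pi; rewrite xz zx; split; apply: equiv_refl.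
by apply/inv_pi; split; [apply: xb | apply: bx].
Qed.

End Gamma.

Record McAlister (S : invSemigroupType) (I : Type) (p : I -> I -> S) : Prop := {
  MF1 : forall i, idempotent_elt (p i i);
  MF2 : forall i j, p i i * p i j * p j j = p i j;
  MF3 : forall i j, p i j = sinv (p j i);
  MF4 : forall i j k, natural_le (p i j * p j k) (p i k);
  MF5 : forall e : S, idempotent_elt e -> exists i, natural_le e (p i i)
}.

Definition rees (S : invSemigroupType) (I : Type) (p : I -> I -> S) : Type :=
  (I * S * I)%type.

Section Rees.
Variables (S : invSemigroupType) (I : Type) (p : I -> I -> S).

(* I is an arbitrary type; semigroupType asks for a choiceType carrier, which
   is provided classically. *)
HB.instance Definition _ := gen_eqMixin (rees p).
HB.instance Definition _ := gen_choiceMixin (rees p).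

Definition rees_mul (x y : rees p) : rees p :=
  let: (i, s, j) := x in let: (k, t, l) := y in (i, s * p j k * t, l).

Lemma rees_mulA : associative rees_mul.
Proof. by move=> [[i s] j] [[k t] l] [[m u] n]; rewrite /= !mulgA. Qed.

HB.instance Definition _ := isSemigroup.Build (rees p) rees_mulA.

Definition rees_reg : {pred rees p} := [pred x | `[< regular_elt x >]].

Lemma rees_reg_mulg_closed : mulg_closed rees_reg.
Proof.
move=> [[i s] j] [[k t] l]; rewrite !inE.
move=> /asboolP[[[k1 a] l1] [sas]] /asboolP[[[k2 b] l2] [tbt]].
apply/asboolP; set u := s * p j k * t; have [v uvu] := inverse_regular u.
have ut : u * p l k2 * b * p l2 k * t = u.
  by rewrite -[RHS]/(s * p j k * t) -[in RHS]tbt !mulgA.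
have su : s * p j k1 * a * p l1 i * u = u by rewrite /u !mulgA sas.
exists (k2, b * p l2 k * t * v * s * p j k1 * a, l1).
congr (_, _, _); rewrite -/u; move: {+}u ut su uvu => w ut su uvu.
by rewrite !mulgA ut -[RHS]uvu -[X in _ = _ * X]su !mulgA.
Qed.

Record RM := MkRM { rm_val :> rees p; rm_reg : rm_val \in rees_reg }.

HB.instance Definition _ := [isSub for rm_val].
HB.instance Definition _ := [Choice of RM by <:].
HB.instance Definition _ :=
  SubChoice_isSubSemigroup.Build (rees p) rees_reg RM rees_reg_mulg_closed.

Lemma RM_regular : regular_semigroup RM.
Proof.
move=> x; have /asboolP[y /is_inverse_of_regular[xz zx]] := rm_reg x.
have z_reg : y * rm_val x * y \in rees_reg.
  by apply/asboolP; exists (rm_val x).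
by exists (MkRM z_reg); apply: val_inj; rewrite !gmulfM.
Qed.

Definition IM : Type := quot (gamma RM).

HB.instance Definition _ := Semigroup.on IM.
HB.instance Definition _ :=
  Semigroup_isInverse.Build IM (gamma_inverse RM_regular).

End Rees.

Record category := Category {
  obj :> Type;
  hom : obj -> obj -> Type;
  idm : forall A, hom A A;
  compm : forall A B C, hom B C -> hom A B -> hom A C;
  compm1 : forall A B (f : hom A B), compm f (idm A) = f;
  comp1m : forall A B (f : hom A B), compm (idm B) f = f;
  compmA : forall A B C D (f : hom C D) (g : hom B C) (h : hom A B),
    compm f (compm g h) = compm (compm f g) h
}.
Arguments idm {c} A.

Record functor (C D : category) := Functor {
  fobj :> C -> D;
  fmap : forall A B, hom A B -> hom (fobj A) (fobj B);
  fmap1 : forall A, fmap (idm A) = idm (fobj A);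
  fmapM : forall A B C' (f : hom B C') (g : hom A B),
    fmap (compm f g) = compm (fmap f) (fmap g)
}.

Definition id_functor (C : category) : functor C C :=
  @Functor C C id (fun _ _ f => f) (fun _ => erefl) (fun _ _ _ _ _ => erefl).

Section CompFunctor.
Variables (C D E : category) (G : functor D E) (F : functor C D).

Lemma comp_fmap1 (A : C) : fmap G (fmap F (idm A)) = idm (G (F A)).
Proof. by rewrite !fmap1. Qed.

Lemma comp_fmapM (A B C' : C) (f : hom B C') (g : hom A B) :
  fmap G (fmap F (compm f g)) = compm (fmap G (fmap F f)) (fmap G (fmap F g)).
Proof. by rewrite !fmapM. Qed.

Definition comp_functor : functor C E := Functor comp_fmap1 comp_fmapM.

End CompFunctor.

Record nat_iso (C D : category) (F G : functor C D) := NatIso {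
  iso_to : forall A, hom (F A) (G A);
  iso_from : forall A, hom (G A) (F A);
  iso_toK : forall A, compm (iso_from A) (iso_to A) = idm (F A);
  iso_fromK : forall A, compm (iso_to A) (iso_from A) = idm (G A);
  iso_natural : forall A B (f : hom A B),
    compm (iso_to B) (fmap F f) = compm (fmap G f) (iso_to A)
}.

Definition equivalent_categories (C D : category) : Prop :=
  exists (F : functor C D) (G : functor D C),
    inhabited (nat_iso (comp_functor G F) (id_functor C)) /\
    inhabited (nat_iso (comp_functor F G) (id_functor D)).

Record unitary_set (S : semigroupType) := UnitarySet {
  uset :> Type;
  act : S -> uset -> uset;
  actM : forall s t x, act (s * t) x = act s (act t x);
  act_unitary : forall x, exists s y, act s y = x
}.

Record uhom (S : semigroupType) (X Y : unitary_set S) := UHom {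
  uhom_fun :> X -> Y;
  uhomE : forall s x, uhom_fun (act s x) = act s (uhom_fun x)
}.

Lemma uhom_ext (S : semigroupType) (X Y : unitary_set S) (f g : uhom X Y) :
  f =1 g -> f = g.
Proof.
case: f g => [f fE] [g gE] /= /funext fg; subst g.
by congr UHom; apply: Prop_irrelevance.
Qed.

Definition uhom_id (S : semigroupType) (X : unitary_set S) : uhom X X :=
  @UHom S X X id (fun _ _ => erefl).

Section UHomComp.
Variables (S : semigroupType) (X Y Z : unitary_set S).
Variables (f : uhom Y Z) (g : uhom X Y).

Lemma uhom_compE s x : (f \o g) (act s x) = act s ((f \o g) x).
Proof. by rewrite /= !uhomE. Qed.

Definition uhom_comp : uhom X Z := UHom uhom_compE.

End UHomComp.

Lemma uhom_compm1 (S : semigroupType) (X Y : unitary_set S) (f : uhom X Y) :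
  uhom_comp f (uhom_id X) = f.
Proof. exact: uhom_ext. Qed.

Lemma uhom_comp1m (S : semigroupType) (X Y : unitary_set S) (f : uhom X Y) :
  uhom_comp (uhom_id Y) f = f.
Proof. exact: uhom_ext. Qed.

Lemma uhom_compA (S : semigroupType) (X Y Z W : unitary_set S)
    (f : uhom Z W) (g : uhom Y Z) (h : uhom X Y) :
  uhom_comp f (uhom_comp g h) = uhom_comp (uhom_comp f g) h.
Proof. exact: uhom_ext. Qed.

Definition Smod (S : semigroupType) : category :=
  @Category (unitary_set S) (@uhom S) (@uhom_id S) (@uhom_comp S)
    (@uhom_compm1 S) (@uhom_comp1m S) (@uhom_compA S).

(* S acting on itself; as a side effect this forces the universe of S-sets to
   contain all semigroups. *)
Lemma regular_act_unitary (S : invSemigroupType) (x : S) :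
  exists s y : S, s * y = x.
Proof. by exists (x * sinv x), x; case: (sinvP x). Qed.

Definition regular_act (S : invSemigroupType) : unitary_set S :=
  @UnitarySet S S mul (fun s t x => esym (mulgA s t x))
    (@regular_act_unitary S).

Definition morita_equivalent (S T : invSemigroupType) : Prop :=
  equivalent_categories (Smod S) (Smod T).

Definition semigroup_iso (S T : semigroupType) : Prop :=
  exists f : {multiplicative S -> T}, bijective f.

(* Main.v *)
Require Import Defs.
From HB Require Import structures.
From mathcomp Require Import all_boot.
From mathcomp Require Import boolp.

(* First half: IM(S,I,p) and S are linked by a Morita context whose bisets P
   and Q are the classes of rows (s,j) and of columns (i,s).  With [Q,P] = T the
   pairing, W |-> {f in Hom_T(Q,W) | f(qs) = f(q) for some s in S and all q}
   defines an equivalence from T-sets to S-sets: the map sending w to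
   (p,q) |-> [q,p]w is bijective, because a unital g with unit [b,a] satisfies
   g(p)(q) = [q,p] g(a)(b).

   Second half: for e in E(T), every jointly epi family into Te contains a
   split epi.  This property is preserved by an equivalence F, and applied to
   the family of all Sf -> F(Te) it makes F(Te) a retract of some Sf, hence
   F(Te) = Sf' for an idempotent f'.  So F transports the corners e_i T e_j
   to corners f_i S f_j by bijections Phi_ij, the McAlister function is
   p_ij = Phi_ij(e_i e_j), and t corresponds to the element of IM(S,I,p) with
   matrix (Phi_kl(t))_kl. *)

Set Implicit Arguments.
Unset Strict Implicit.
Unset Printing Implicit Defensive.

Local Open Scope group_scope.
Local Open Scope quotient_scope.

(** * Inverse semigroups *)

Section InverseSemigroup.
Variable S : invSemigroupType.
Implicit Types a b c e f s t : S.

Lemma inverse_uniq a b c : is_inverse_of a b -> is_inverse_of a c -> b = c.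
Proof. by have [d [_ ud]] := inverse_semigroupP a => /ud <- /ud. Qed.

Lemma is_inverse_of_sym a b : is_inverse_of a b -> is_inverse_of b a.
Proof. by case. Qed.

Lemma sinv_uniq a b : is_inverse_of a b -> sinv a = b.
Proof. exact/inverse_uniq/sinvP. Qed.

Lemma mulsVs a : a * sinv a * a = a. Proof. by case: (sinvP a). Qed.

Lemma mulVsV a : sinv a * a * sinv a = sinv a. Proof. by case: (sinvP a). Qed.

Lemma sinvK : involutive (@sinv S).
Proof. by move=> a; apply/sinv_uniq/is_inverse_of_sym/sinvP. Qed.

Lemma idem_sinv e : idempotent_elt e -> sinv e = e.
Proof. by move=> ee; apply: sinv_uniq; split; rewrite !ee. Qed.

Lemma mulKidem e x : idempotent_elt e -> x * e * e = x * e.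
Proof. by move=> ee; rewrite -mulgA ee. Qed.

Lemma idem_mulsV a : idempotent_elt (a * sinv a).
Proof. by rewrite /idempotent_elt mulgA mulsVs. Qed.

Lemma idem_mulVs a : idempotent_elt (sinv a * a).
Proof. by rewrite /idempotent_elt mulgA mulVsV. Qed.

(* The inverse x of ef satisfies fxe = x, so x, hence ef, is idempotent. *)
Lemma idemM e f : idempotent_elt e -> idempotent_elt f ->
  idempotent_elt (e * f).
Proof.
move=> ee ff; have [efx xef] := sinvP (e * f); set x := sinv _ in efx xef.
have fxef : f * x * e * f * x * e = f * x * e by rewrite -{3}xef !mulgA.
have fxe : f * x * e = x.
  apply: (@inverse_uniq (e * f)); split=> //.
    by rewrite !mulgA mulKidem // mulKidem // -[RHS]efx !mulgA.
  by rewrite !mulgA mulKidem // mulKidem.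
have xx : idempotent_elt x by rewrite /idempotent_elt -fxe !mulgA.
by rewrite -(sinvK (e * f)) -/x (idem_sinv xx).
Qed.

(** Both products are idempotent by [idemM], so [f * e] is an inverse of [e * f], which is also its
    own inverse; inverses are unique. *)
Lemma idemC e f : idempotent_elt e -> idempotent_elt f -> e * f = f * e.
Proof.
move=> ee ff; have [efef fefe] := (idemM ee ff, idemM ff ee).
rewrite -(idem_sinv efef); apply: sinv_uniq; split.
  by rewrite !mulgA mulKidem // mulKidem // -[RHS]efef !mulgA.
by rewrite !mulgA mulKidem // mulKidem // -[RHS]fefe !mulgA.
Qed.

Lemma mulIidem x e f : idempotent_elt e -> idempotent_elt f ->
  x * e * f = x * f * e.
Proof. by move=> ee ff; rewrite -!mulgA (idemC ee). Qed.

Lemma sinvM a b : sinv (a * b) = sinv b * sinv a.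
Proof.
have key c d : c * d * (sinv d * sinv c) * (c * d) = c * d.
  have := mulIidem c (idem_mulsV d) (idem_mulVs c); rewrite !mulgA => ->.
  by rewrite mulsVs -(mulgA c d) -(mulgA c) mulsVs.
apply: sinv_uniq; split; first exact: key.
by have := key (sinv b) (sinv a); rewrite !sinvK.
Qed.

Lemma idem_conj a e : idempotent_elt e -> idempotent_elt (a * e * sinv a).
Proof.
move=> ee; rewrite /idempotent_elt !mulgA -(mulgA _ (sinv a) a).
by rewrite (mulIidem a ee (idem_mulVs a)) mulKidem // mulgA mulsVs.
Qed.

(** Write [a] as a a^-1 a and commute [e] with the idempotent a a^-1. This turns left multiples by
    idempotents into right ones, so [natural_le] is left-right symmetric. *)
Lemma mul_idem e a : idempotent_elt e -> e * a = a * (sinv a * e * a).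
Proof.
move=> ee; rewrite !mulgA -mulgA; rewrite -{1}(mulsVs a) !mulgA.
by rewrite -(mulgA e) (idemC ee) ?mulgA //; apply: idem_mulsV.
Qed.

Lemma idem_conjV a e : idempotent_elt e -> idempotent_elt (sinv a * e * a).
Proof. by move=> /(@idem_conj (sinv a)); rewrite sinvK. Qed.

Lemma le_mulr t e : idempotent_elt e -> natural_le (t * e) t.
Proof. by exists e. Qed.

Lemma le_mull t e : idempotent_elt e -> natural_le (e * t) t.
Proof.
by move=> ee; exists (sinv t * e * t); rewrite -mul_idem //; split => //;
   apply: idem_conjV.
Qed.

Lemma le_refl s : natural_le s s.
Proof. by rewrite -{1}(mulsVs s) -mulgA; apply/le_mulr/idem_mulVs. Qed.

Lemma le_trans s t u : natural_le s t -> natural_le t u -> natural_le s u.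
Proof.
move=> [e [ee ->]] [f [ff ->]]; rewrite -mulgA.
exact/le_mulr/idemM.
Qed.

Lemma le_antisym s t : natural_le s t -> natural_le t s -> s = t.
Proof.
move=> [e [ee st]] [f [ff ts]]; rewrite st; rewrite {1}ts mulIidem //.
by rewrite st mulKidem // -st.
Qed.

Lemma le_mul s s' t t' :
  natural_le s s' -> natural_le t t' -> natural_le (s * t) (s' * t').
Proof.
move=> [e [ee ->]] [f [ff ->]].
rewrite -!mulgA (mulgA e) (mul_idem _ ee) -!mulgA mulgA.
by apply/le_mulr; rewrite !mulgA; apply: idemM => //; apply: idem_conjV.
Qed.

Lemma le_sinv s t : natural_le s t -> natural_le (sinv s) (sinv t).
Proof. by move=> [e [ee ->]]; rewrite sinvM idem_sinv //; apply: le_mull. Qed.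

(** The element [b * a * b] is the inverse of [a], and it is [b] times the idempotent [a * b]. *)
Lemma sinv_le a b : a * b * a = a -> natural_le (sinv a) b.
Proof.
move=> aba; pose d := b * a * b.
have ->: sinv a = d by apply/sinv_uniq/is_inverse_of_regular.
have ab : idempotent_elt (a * b) by rewrite /idempotent_elt mulgA aba.
by rewrite /d -mulgA; apply: le_mulr.
Qed.

End InverseSemigroup.

(** * Morita contexts *)

Lemma unitary_idem (S : invSemigroupType) (X : unitary_set S) (x : X) :
  exists2 e : S, idempotent_elt e & act e x = x.
Proof.
have [s [y <-]] := act_unitary x; exists (s * sinv s); first exact: idem_mulsV.
by rewrite -actM mulsVs.
Qed.

(** * Unitary sets of functions on a right S-set *)

Section UnitalFunctions.
Variables (S : invSemigroupType) (Q V : Type) (r : Q -> S -> Q).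
Hypothesis rM : forall q s t, r q (s * t) = r (r q s) t.
Variable C : (Q -> V) -> Prop.
Hypothesis C_r : forall s f, C f -> C (fun q => f (r q s)).

(** S acts by (s f)(q) = f(q s), and being fixed by some s is what makes this action unitary. The
    predicate [C] is left open to serve both for homomorphisms into a T-set and for arbitrary
    functions into [Prop]. *)
Definition unital : Type :=
  {f : Q -> V | C f /\ exists s, forall q, f (r q s) = f q}.

Lemma unital_ext (f g : unital) : sval f =1 sval g -> f = g.
Proof.
case: f g => [f fP] [g gP] /= /funext fg; subst g.
by congr exist; apply: Prop_irrelevance.
Qed.

Lemma unital_act_subproof s (f : unital) :
  C (fun q => sval f (r q s)) /\
  exists t, forall q, sval f (r (r q t) s) = sval f (r q s).
Proof.
split; first by apply: C_r; case: (svalP f).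
by exists (s * sinv s) => q; rewrite -rM mulsVs.
Qed.

Definition unital_act s (f : unital) : unital :=
  exist _ _ (unital_act_subproof s f).

Lemma unital_actM s t f : unital_act (s * t) f = unital_act s (unital_act t f).
Proof. by apply: unital_ext => q /=; rewrite rM. Qed.

Lemma unital_act_unitary f : exists s g, unital_act s g = f.
Proof.
by case: (svalP f) => _ [s fs]; exists s, f; apply: unital_ext => q /=.
Qed.

Definition unital_set : unitary_set S :=
  UnitarySet unital_actM unital_act_unitary.

End UnitalFunctions.

Record biset (S T : semigroupType) := Biset {
  bcar :> Type;
  lact : S -> bcar -> bcar;
  ract : bcar -> T -> bcar;
  lactM : forall s s' x, lact (s * s') x = lact s (lact s' x);
  ractM : forall x t t', ract x (t * t') = ract (ract x t) t';
  lractA : forall s x t, lact s (ract x t) = ract (lact s x) t;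
  lact_unit : forall x, exists s, lact s x = x
}.

(** The pairings are given as balanced maps on pairs of elements, so that no tensor product has to
    be formed. *)
Record morita_context (S T : semigroupType) := MoritaContext {
  cP : biset S T;
  cQ : biset T S;
  pairS : cP -> cQ -> S;
  pairT : cQ -> cP -> T;
  pairS_lact : forall s p q, pairS (lact s p) q = s * pairS p q;
  pairT_lact : forall t q p, pairT (lact t q) p = t * pairT q p;
  pairS_ract : forall p q s, pairS p (ract q s) = pairS p q * s;
  pairT_ract : forall q p t, pairT q (ract p t) = pairT q p * t;
  pairS_bal : forall p t q, pairS (ract p t) q = pairS p (lact t q);
  pairT_bal : forall q s p, pairT (ract q s) p = pairT q (lact s p);
  pairST : forall p q p', lact (pairS p q) p' = ract p (pairT q p');
  pairTS : forall q p q', lact (pairT q p) q' = ract q (pairS p q');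
  pairS_surj : forall s, exists p q, pairS p q = s;
  pairT_surj : forall t, exists q p, pairT q p = t
}.

Definition context_swap (S T : semigroupType) (c : morita_context S T) :
  morita_context T S :=
  MoritaContext (pairT_lact (m := c)) (@pairS_lact _ _ c)
    (@pairT_ract _ _ c) (@pairS_ract _ _ c) (@pairT_bal _ _ c)
    (@pairS_bal _ _ c) (@pairTS _ _ c) (@pairST _ _ c)
    (@pairT_surj _ _ c) (@pairS_surj _ _ c).

(** * The functor induced by a Morita context *)

Section ContextFunctor.
Variables (S T : invSemigroupType) (c : morita_context S T).

Definition lact_hom (W : unitary_set T) (f : cQ c -> W) : Prop :=
  forall t q, f (lact t q) = act t (f q).

Lemma lact_hom_ract (W : unitary_set T) s (f : cQ c -> W) :
  lact_hom f -> lact_hom (fun q => f (ract q s)).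
Proof. by move=> fE t q; rewrite -lractA fE. Qed.

Definition ctx_obj (W : unitary_set T) : unitary_set S :=
  unital_set (@ractM _ _ (cQ c)) (@lact_hom_ract W).

Section Map.
Variables (W W' : unitary_set T) (h : uhom W W').

Lemma ctx_map_subproof (f : ctx_obj W) :
  lact_hom (h \o sval f) /\
  exists s, forall q, (h \o sval f) (ract q s) = (h \o sval f) q.
Proof.
case: (svalP f) => fE [s fs]; split=> [t q|]; first by rewrite /= fE uhomE.
by exists s => q /=; rewrite fs.
Qed.

Definition ctx_fun (f : ctx_obj W) : ctx_obj W' :=
  exist _ _ (ctx_map_subproof f).

Lemma ctx_funE s (f : ctx_obj W) : ctx_fun (act s f) = act s (ctx_fun f).
Proof. exact: unital_ext. Qed.

Definition ctx_map : uhom (ctx_obj W) (ctx_obj W') := UHom ctx_funE.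

End Map.

Lemma ctx_map1 (W : unitary_set T) :
  ctx_map (uhom_id W) = uhom_id (ctx_obj W).
Proof. by apply: uhom_ext => f; apply: unital_ext. Qed.

Lemma ctx_mapM (W1 W2 W3 : unitary_set T) (h : uhom W2 W3) (k : uhom W1 W2) :
  ctx_map (uhom_comp h k) = uhom_comp (ctx_map h) (ctx_map k).
Proof. by apply: uhom_ext => f; apply: unital_ext. Qed.

Definition ctx_functor : functor (Smod T) (Smod S) :=
  @Functor (Smod T) (Smod S) ctx_obj ctx_map ctx_map1 ctx_mapM.

End ContextFunctor.

(** * The natural isomorphism between a T-set and its double image *)

Section ContextUnit.
Variables (S T : invSemigroupType) (c : morita_context S T).
Let F := @ctx_obj S T c.
Let G := @ctx_obj T S (context_swap c).

Section Object.
Variable W : unitary_set T.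

Lemma ctx_unit1_subproof (w : W) (p : cP c) :
  lact_hom (fun q : cQ c => act (pairT q p) w) /\
  exists s, forall q, act (pairT (ract q s) p) w = act (pairT q p) w.
Proof.
split=> [t q|]; first by rewrite pairT_lact actM.
by have [s sp] := lact_unit p; exists s => q; rewrite pairT_bal sp.
Qed.

Definition ctx_unit1 (w : W) (p : cP c) : F W :=
  exist _ _ (ctx_unit1_subproof w p).

Lemma ctx_unit2_subproof (w : W) :
  @lact_hom T S (context_swap c) (F W) (ctx_unit1 w) /\
  exists t, forall p, ctx_unit1 w (ract p t) = ctx_unit1 w p.
Proof.
split=> [s p|]; first by apply: unital_ext => q /=; rewrite pairT_bal.
have [t [y yw]] := act_unitary w; exists (t * sinv t) => p.
apply: unital_ext => q /=.
by rewrite pairT_ract actM -yw -(actM (_ * _)) mulsVs.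
Qed.

Definition ctx_unit2 (w : W) : G (F W) := exist _ _ (ctx_unit2_subproof w).

Lemma ctx_unit2E t (w : W) : ctx_unit2 (act t w) = act t (ctx_unit2 w).
Proof.
apply: unital_ext => p; apply: unital_ext => q /=.
by rewrite pairT_ract actM.
Qed.

Definition ctx_unit : uhom W (G (F W)) := UHom ctx_unit2E.

Lemma ctx_unitE w p q : sval (sval (ctx_unit w) p) q = act (pairT q p) w.
Proof. by []. Qed.

(** The values [q,p] exhaust T, so t w = t w' for every t. With idempotents e fixing w and f fixing
    w', commutation gives w = e w' = e f w' = f e w = f w = w'. *)
Lemma ctx_unit_inj : injective ctx_unit.
Proof.
move=> w w' ww'.
have eq_act t : act t w = act t w'.
  by have [q [p <-]] := pairT_surj c t; rewrite -!ctx_unitE ww'.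
have [[e ee ew] [f ff fw']] := (unitary_idem w, unitary_idem w').
by rewrite -ew eq_act -{1}fw' -actM idemC // actM -eq_act ew eq_act fw'.
Qed.

Lemma ctx_unit_surj (g : G (F W)) : exists w, ctx_unit w = g.
Proof.
have [gE [t gt]] := svalP g; have [b [a ab]] := pairT_surj c t.
exists (sval (sval g a) b); apply: unital_ext => p; apply: unital_ext => q /=.
have [fE _] := svalP (sval g a).
(* Here t = [b,a] is the unit of g, and [q,p] g(a)(b) = g(a)([q,p] b) = g(a)(q <p,b>) = g(<p,b>
   a)(q) = g(p [b,a])(q) = g(p)(q), where <p,b> is the S-valued pairing. *)
rewrite -fE pairTS -(gt p) -[t]ab -(@pairST _ _ c).
by rewrite (gE (pairS p b)).
Qed.

Definition ctx_unit_inv (g : G (F W)) : W := sval (cid (ctx_unit_surj g)).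

Lemma ctx_unit_invK : cancel ctx_unit_inv ctx_unit.
Proof. by move=> g; apply: svalP (cid (ctx_unit_surj g)). Qed.

Lemma ctx_unitK : cancel ctx_unit ctx_unit_inv.
Proof. by move=> w; apply: ctx_unit_inj; rewrite ctx_unit_invK. Qed.

Lemma ctx_unit_invE t g : ctx_unit_inv (act t g) = act t (ctx_unit_inv g).
Proof. by apply: ctx_unit_inj; rewrite uhomE !ctx_unit_invK. Qed.

Definition ctx_counit : uhom (G (F W)) W := UHom ctx_unit_invE.

End Object.

Lemma ctx_counit_natural (W W' : unitary_set T) (h : uhom W W') :
  uhom_comp (ctx_counit W') (ctx_map (context_swap c) (ctx_map c h)) =
  uhom_comp h (ctx_counit W).
Proof.
apply: uhom_ext => g /=; apply: ctx_unit_inj; rewrite ctx_unit_invK.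
apply: unital_ext => p; apply: unital_ext => q /=.
by rewrite -{1}(ctx_unit_invK g) /= uhomE.
Qed.

Lemma ctx_nat_iso :
  nat_iso (comp_functor (ctx_functor (context_swap c)) (ctx_functor c))
    (id_functor (Smod T)).
Proof.
apply: (@NatIso (Smod T) (Smod T)
  (comp_functor (ctx_functor (context_swap c)) (ctx_functor c))
  (id_functor (Smod T)) ctx_counit ctx_unit) => [W|W|W W' h].
- by apply: uhom_ext => g; apply: ctx_unit_invK.
- by apply: uhom_ext => w; apply: ctx_unitK.
- exact: ctx_counit_natural.
Qed.

End ContextUnit.

(** The context axioms are symmetric in S and T, so the second composite is the first one for the
    swapped context. *)
Lemma morita_contextP (S T : invSemigroupType) :
  morita_context S T -> morita_equivalent T S.
Proof.
move=> c; exists (ctx_functor c), (ctx_functor (context_swap c)); split.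
  exact: inhabits (ctx_nat_iso c).
have := ctx_nat_iso (context_swap c).
by have ->: context_swap (context_swap c) = c by case: c.
Qed.

(** * Inverse Rees matrix semigroups *)

Section ReesMatrix.
Variables (S : invSemigroupType) (I : Type) (p : I -> I -> S).
Hypothesis pM : McAlister p.
Implicit Types (i j k l m n : I) (s t u : S).

Lemma mcA_l i j : p i i * p i j = p i j.
Proof. by rewrite -(MF2 pM i j) !mulgA (MF1 pM i). Qed.

Lemma mcA_r i j : p i j * p j j = p i j.
Proof. by rewrite -(MF2 pM i j) -!mulgA (MF1 pM j). Qed.

Lemma mcA_rx x i j : x * p i j * p j j = x * p i j.
Proof. by rewrite -mulgA mcA_r. Qed.

Lemma mcA_lx x i j : x * p i i * p i j = x * p i j.
Proof. by rewrite -mulgA mcA_l. Qed.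

(** The entries record how [x] appears when multiplied by [p] on both sides; this matrix is a
    complete invariant of the [gamma]-class, see [gammaE]. *)
Definition rees_mx (x : rees p) k l : S :=
  p k x.1.1 * x.1.2 * p x.2 l.

(** If s = s b s with b in the corner p_jj S p_ii, then b s b lies in that corner and s is its
    inverse, hence lies in p_ii S p_jj. Conversely (j, s^-1, i) witnesses regularity. *)
Lemma regularE i s j :
  regular_elt ((i, s, j) : rees p) <-> p i i * s * p j j = s.
Proof.
split=> [[[[k t] l]] [sts]|sE].
  set b := p j k * t * p l i; have sbs : s * b * s = s by rewrite !mulgA.
  have bE : p j j * b * p i i = b by rewrite /b !mulgA mcA_l mcA_rx.
  have := is_inverse_of_regular sbs; set d := b * s * b => sd.
  have <- : sinv d = s by apply/sinv_uniq/is_inverse_of_sym.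
  have dE : p j j * d * p i i = d.
    by rewrite /d !mulgA -[in RHS]bE /b !mulgA !mcA_rx !mcA_l.
  move: dE; move: {+}d => c <-; rewrite !sinvM -!(MF3 pM) !mulgA.
  by rewrite (mulKidem _ (MF1 pM j)) (MF1 pM i).
exists ((j, sinv s, i) : rees p); congr (_, _, _).
have ps : p i i * s = s by rewrite -sE !mulgA (MF1 pM i).
have sp : s * p j j = s by rewrite -sE (mulKidem _ (MF1 pM j)).
by rewrite sp -mulgA ps mulsVs.
Qed.

Lemma RM_corner (x : RM p) :
  p (rm_val x).1.1 (rm_val x).1.1 * (rm_val x).1.2 *
    p (rm_val x).2 (rm_val x).2 = (rm_val x).1.2.
Proof. by case: x => [[[i s] j] /= /asboolP/regularE]. Qed.

Lemma mkrm_reg i s j :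
  ((i, p i i * s * p j j, j) : rees p) \in rees_reg (p := p).
Proof.
apply/asboolP/regularE; rewrite mulgA (mulKidem _ (MF1 pM j)).
by rewrite mulgA (MF1 pM i).
Qed.

Definition mkrm i s j : RM p := MkRM (mkrm_reg i s j).

Lemma mkrm_surj (x : RM p) : exists i s j, x = mkrm i s j.
Proof.
have := RM_corner x; case: x => [[[i s] j] xr] /= sE; exists i, s, j.
by apply: val_inj => /=; rewrite sE.
Qed.

Lemma rees_mxM (x y : RM p) k l :
  rees_mx (x * y) k l =
  rees_mx x k (rm_val y).1.1 * (rm_val y).1.2 * p (rm_val y).2 l.
Proof.
by case: x y => [[[i s] j] ?] [[[m t] n] ?]; rewrite /rees_mx /= !mulgA.
Qed.

Lemma rees_mxM' (x y : RM p) k l :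
  rees_mx (x * y) k l =
  p k (rm_val x).1.1 * (rm_val x).1.2 * rees_mx y (rm_val x).2 l.
Proof.
by case: x y => [[[i s] j] ?] [[[m t] n] ?]; rewrite /rees_mx /= !mulgA.
Qed.

Definition mx_rel : rel (RM p) :=
  fun x y => `[< forall k l, rees_mx x k l = rees_mx y k l >].

Lemma mx_relP (x y : RM p) :
  reflect (forall k l, rees_mx x k l = rees_mx y k l) (mx_rel x y).
Proof. exact: asboolP. Qed.

Lemma mx_refl : reflexive mx_rel.
Proof. by move=> x; apply/mx_relP. Qed.

Lemma mx_sym : symmetric mx_rel.
Proof. by move=> x y; apply/mx_relP/mx_relP. Qed.

Lemma mx_trans : transitive mx_rel.
Proof.
by move=> y x z /mx_relP xy /mx_relP yz; apply/mx_relP => k l; rewrite xy.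
Qed.

Lemma mx_relM (x x' y y' : RM p) :
  mx_rel x x' -> mx_rel y y' -> mx_rel (x * y) (x' * y').
Proof.
move=> /mx_relP xx /mx_relP yy; apply/mx_relP => k l.
by rewrite rees_mxM xx -rees_mxM rees_mxM' yy -rees_mxM'.
Qed.

Definition mx_cong : congruence (RM p) :=
  @Congruence _ (EquivRel mx_rel mx_refl mx_sym mx_trans) mx_relM.

Lemma rees_mx_corner (x : RM p) :
  rees_mx x (rm_val x).1.1 (rm_val x).2 = (rm_val x).1.2.
Proof. exact: RM_corner. Qed.

Lemma mx_rel_eq (x y : RM p) :
  (rm_val x).1.1 = (rm_val y).1.1 -> (rm_val x).2 = (rm_val y).2 ->
  mx_rel x y -> x = y.
Proof.
move=> e1 e2 /mx_relP xy; apply: val_inj => /=.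
have := rees_mx_corner x; rewrite xy e1 e2 rees_mx_corner.
by case: x y e1 e2 {xy} => [[[i s] j] ?] [[[k t] l] ?] /= -> -> ->.
Qed.

(** The outer indices of [x * y * x] are those of [x], and the entry at these indices is the middle
    component. Hence inverses modulo [mx_rel] are genuine inverses in RM. *)
Lemma mx_relXYX (x y : RM p) : mx_rel (x * y * x) x -> x * y * x = x.
Proof.
apply: mx_rel_eq; case: x y => [[[i s] j] ?] [[[k t] l] ?] //.
Qed.

(** All inverses of [x] have the same matrix. The two regularity equations bound s^-1 and t by each
    other up to factors of [p], and (MF4) absorbs these factors, so antisymmetry applies. *)
Lemma RM_inverse_mx (x y : RM p) k l : is_inverse_of x y ->
  rees_mx y k l = p k (rm_val x).2 * sinv (rm_val x).1.2 * p (rm_val x).1.1 l.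
Proof.
case: x y => [[[i s] j] xr] [[[m t] n] yr] [].
move=> /(congr1 (@rm_val _ _ _))[sts] /(congr1 (@rm_val _ _ _))[tst].
rewrite /rees_mx /=.
have le1 : natural_le (sinv s) (p j m * t * p n i).
  by apply: sinv_le; rewrite !mulgA.
have le2 : natural_le t (p m j * sinv s * p i n).
  rewrite (MF3 pM m j) (MF3 pM i n) -!sinvM -{1}(sinvK t); apply: le_sinv.
  by apply: sinv_le; rewrite !mulgA.
apply: le_antisym.
  apply: le_trans (le_mul (le_mul (le_refl _) le2) (le_refl _)) _.
  have := le_mul (MF4 pM k m j) (le_mul (le_refl (sinv s)) (MF4 pM i n l)).
  by rewrite !mulgA.
apply: le_trans (le_mul (le_mul (le_refl _) le1) (le_refl _)) _.
have := le_mul (MF4 pM k j m) (le_mul (le_refl t) (MF4 pM n i l)).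
by rewrite !mulgA.
Qed.

Lemma quot_inverseP (rho : congruence (RM p)) (x y : RM p) :
  is_inverse_of (\pi_(quot rho) x) (\pi_(quot rho) y) <->
  rho (x * y * x) x /\ rho (y * x * y) y.
Proof.
by rewrite /is_inverse_of -!piM; split=> -[? ?]; split; apply/quot_eqP.
Qed.

Lemma mx_inverse : inverse_semigroup (quot mx_cong).
Proof.
move=> a; rewrite -[a]reprK; set x := repr a.
have [y /is_inverse_of_regular xy] := RM_regular x.
exists (\pi_(quot mx_cong) (y * x * y)); split.
  by apply/quot_inverseP; case: xy => -> ->; split; apply: equiv_refl.
move=> b; rewrite -[b]reprK => /quot_inverseP[/mx_relXYX xb /mx_relXYX bx].
apply/quot_eqP/mx_relP => k l.
by rewrite (RM_inverse_mx _ _ (conj xb bx)) (RM_inverse_mx _ _ xy).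
Qed.

(* An inverse of y is also an inverse of every x with the same matrix, so
   x and y are identified by every inverse congruence. *)
Lemma gammaE (x y : RM p) : gamma (RM p) x y <-> mx_rel x y.
Proof.
split=> [/asboolP/(_ mx_cong mx_inverse)//|xy].
apply/asboolP => rho inv.
have [w /is_inverse_of_regular[yz zy]] := RM_regular y.
set z := w * y * w in yz zy.
have xz : x * z * x = x.
  apply: mx_relXYX; apply: (@mx_trans y); last by rewrite mx_sym.
  by rewrite -[X in mx_rel _ X]yz; do 2?[apply: mx_relM] => //; apply: mx_refl.
have zx : z * x * z = z.
  apply: mx_relXYX; rewrite -[X in mx_rel _ X]zy.
  by do 2?[apply: mx_relM] => //; apply: mx_refl.
apply/quot_eqP; have [v [_ uv]] := inv (\pi_(quot rho) z).
rewrite -(uv (\pi_(quot rho) x)).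
  by apply: uv; rewrite /is_inverse_of -!piM yz zy.
by rewrite /is_inverse_of -!piM xz zx.
Qed.

End ReesMatrix.

(** * The quotient by gamma and its Morita context with S *)

Section InverseReesMatrix.
Variables (S : invSemigroupType) (I : Type) (p : I -> I -> S).
Hypothesis pM : McAlister p.
Implicit Types (i j k l m n : I) (s t u : S).

(** The chosen representative is immaterial, as [gamma] is equality of matrices. *)
Definition imx (a : IM p) k l : S := rees_mx (repr a) k l.

Definition elt i s j : IM p := \pi_(quot (gamma (RM p))) (mkrm pM i s j).

Lemma imx_inj (a b : IM p) : (forall k l, imx a k l = imx b k l) -> a = b.
Proof.
move=> ab; rewrite -[a]reprK -[b]reprK.
by apply/quot_eqP/(gammaE pM)/mx_relP.
Qed.

Lemma elt_surj (a : IM p) : exists i s j, a = elt i s j.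
Proof.
have [i [s [j e]]] := mkrm_surj pM (repr a).
by exists i, s, j; rewrite /elt -e reprK.
Qed.

Lemma imx_elt i s j k l : imx (elt i s j) k l = p k i * s * p j l.
Proof.
have /quot_eqP/(gammaE pM)/mx_relP := reprK (elt i s j).
by rewrite /imx => ->; rewrite /rees_mx /= !mulgA (mcA_lx pM) (mcA_r pM).
Qed.

Lemma eltP i s j i' s' j' :
  (forall k l, p k i * s * p j l = p k i' * s' * p j' l) ->
  elt i s j = elt i' s' j'.
Proof. by move=> e; apply: imx_inj => k l; rewrite !imx_elt. Qed.

Lemma eltM i s j k t l : elt i s j * elt k t l = elt i (s * p j k * t) l.
Proof.
rewrite /elt -piM; apply/quot_eqP/(gammaE pM)/mx_relP => m n.
by rewrite /rees_mx /= !mulgA !(mcA_lx pM) !(mcA_rx pM) !(mcA_r pM).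
Qed.

Lemma imx_mulr (a : IM p) i s j k l :
  imx (a * elt i s j) k l = imx a k i * s * p j l.
Proof. by have [m [t [n ->]]] := elt_surj a; rewrite eltM !imx_elt !mulgA. Qed.

(* The class of (s, j) in the biset of rows is encoded by the function
   l |-> s p_{j,l}, and dually for columns. *)
Definition row_of : Type :=
  {x : I -> S | exists r : S * I, forall l, x l = r.1 * p r.2 l}.
Definition col_of : Type :=
  {y : I -> S | exists r : I * S, forall k, y k = p k r.1 * r.2}.

Lemma mkrow_subproof s j :
  exists r : S * I, forall l, s * p j l = r.1 * p r.2 l.
Proof. by exists (s, j). Qed.
Definition mkrow s j : row_of := exist _ _ (mkrow_subproof s j).

Lemma mkcol_subproof i s :
  exists r : I * S, forall k, p k i * s = p k r.1 * r.2.
Proof. by exists (i, s). Qed.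
Definition mkcol i s : col_of := exist _ _ (mkcol_subproof i s).

Definition row_rep (x : row_of) : S * I := sval (cid (svalP x)).
Definition col_rep (y : col_of) : I * S := sval (cid (svalP y)).

Lemma row_repE x l : (row_rep x).1 * p (row_rep x).2 l = sval x l.
Proof. by rewrite (svalP (cid (svalP x))). Qed.

Lemma col_repE y k : p k (col_rep y).1 * (col_rep y).2 = sval y k.
Proof. by rewrite (svalP (cid (svalP y))). Qed.

Lemma row_ext (x x' : row_of) : sval x =1 sval x' -> x = x'.
Proof.
case: x x' => [x xP] [x' x'P] /= /funext e; subst x'.
by congr exist; apply: Prop_irrelevance.
Qed.

Lemma col_ext (y y' : col_of) : sval y =1 sval y' -> y = y'.
Proof.
case: y y' => [y yP] [y' y'P] /= /funext e; subst y'.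
by congr exist; apply: Prop_irrelevance.
Qed.

Lemma row_surj x : exists s j, x = mkrow s j.
Proof.
exists (row_rep x).1, (row_rep x).2.
by apply: row_ext => l /=; rewrite row_repE.
Qed.

Lemma col_surj y : exists i s, y = mkcol i s.
Proof.
exists (col_rep y).1, (col_rep y).2.
by apply: col_ext => k /=; rewrite col_repE.
Qed.

Definition row_lact s (x : row_of) : row_of :=
  mkrow (s * (row_rep x).1) (row_rep x).2.

Definition row_ract (x : row_of) (a : IM p) : row_of :=
  let: (i, u, j) := rm_val (repr a) in mkrow (sval x i * u) j.

Definition col_lact (a : IM p) (y : col_of) : col_of :=
  let: (i, u, j) := rm_val (repr a) in mkcol i (u * sval y j).

Definition col_ract (y : col_of) s : col_of :=
  mkcol (col_rep y).1 ((col_rep y).2 * s).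

Definition row_col (x : row_of) (y : col_of) : S :=
  (row_rep x).1 * sval y (row_rep x).2.

Definition col_row (y : col_of) (x : row_of) : IM p :=
  elt (col_rep y).1 ((col_rep y).2 * (row_rep x).1) (row_rep x).2.

Lemma row_lactE t s j : row_lact t (mkrow s j) = mkrow (t * s) j.
Proof. by apply: row_ext => l /=; rewrite -mulgA row_repE /= mulgA. Qed.

Lemma col_ractE i s t : col_ract (mkcol i s) t = mkcol i (s * t).
Proof. by apply: col_ext => k /=; rewrite mulgA col_repE /= mulgA. Qed.

Lemma row_ractE s j k u l :
  row_ract (mkrow s j) (elt k u l) = mkrow (s * p j k * u) l.
Proof.
apply: row_ext => n; have := imx_elt k u l j n.
rewrite /row_ract /imx; case: (rm_val _) => [[i v] m] /=.
by rewrite /rees_mx /= -!mulgA => ->.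
Qed.

Lemma col_lactE i u j k s :
  col_lact (elt i u j) (mkcol k s) = mkcol i (u * p j k * s).
Proof.
apply: col_ext => n; have := imx_elt i u j n k.
rewrite /col_lact /imx; case: (rm_val _) => [[i' v] m] /=.
by rewrite /rees_mx /= !mulgA => ->.
Qed.

Lemma row_colE s j k t : row_col (mkrow s j) (mkcol k t) = s * p j k * t.
Proof. by rewrite /row_col /= mulgA row_repE. Qed.

Lemma col_rowE k t s j : col_row (mkcol k t) (mkrow s j) = elt k (t * s) j.
Proof.
by apply: eltP => m n; rewrite !mulgA col_repE -(mulgA _ (row_rep _).1) row_repE
   /= !mulgA.
Qed.

(** These rules evaluate every operation on arbitrary representatives, so the choices made by
    [row_rep], [col_rep] and [repr] disappear and most axioms of the context reduce to
    associativity. *)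
Definition reesE := (row_lactE, col_ractE, row_ractE, col_lactE, row_colE,
  col_rowE, eltM).

Lemma row_lact_unit x : exists s, row_lact s x = x.
Proof.
have [s [j ->]] := row_surj x; exists (s * sinv s).
by rewrite row_lactE mulsVs.
Qed.

Lemma col_lact_unit y : exists a, col_lact a y = y.
Proof.
have [i [s ->]] := col_surj y; exists (elt i (p i i) i).
rewrite col_lactE (MF1 pM); apply: col_ext => k /=.
by rewrite mulgA (mcA_r pM).
Qed.

Ltac rees_cases := intros;
  repeat match goal with
  | x : row_of |- _ => have [? [? ->]] := row_surj x; clear x
  | y : col_of |- _ => have [? [? ->]] := col_surj y; clear y
  | a : _ |- _ => have [? [? [? ->]]] := elt_surj a; clear a
  end; rewrite ?reesE ?mulgA.

Definition row_biset : biset S (IM p).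
Proof.
by apply: (@Biset S (IM p) row_of row_lact row_ract _ _ _ row_lact_unit);
  rees_cases.
Defined.

Definition col_biset : biset (IM p) S.
Proof.
by apply: (@Biset (IM p) S col_of col_lact col_ract _ _ _ col_lact_unit);
  rees_cases.
Defined.

Definition rees_context : morita_context S (IM p).
Proof.
apply: (@MoritaContext S (IM p) row_biset col_biset row_col col_row);
  cbn [lact ract bcar row_biset col_biset]; try by rees_cases.
(* By (MF5) the idempotent s^-1 s lies below some p_ii, so the row (s,i) and the column (i, s^-1 s)
   pair to s s^-1 s = s. *)
- move=> s; have [i [f [ff e]]] := MF5 pM (idem_mulVs s).
  exists (mkrow s i), (mkcol i (sinv s * s)); rewrite row_colE.
  have pe : p i i * (sinv s * s) = sinv s * s by rewrite e mulgA (MF1 pM).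
  by rewrite -mulgA pe mulgA mulsVs.
- move=> a; have [i [s [j ->]]] := elt_surj a.
  exists (mkcol i (s * sinv s)), (mkrow s j).
  by rewrite col_rowE mulsVs.
Defined.

Lemma IM_morita : morita_equivalent (IM p) S.
Proof. exact: morita_contextP rees_context. Qed.

End InverseReesMatrix.

(** * Equivalences of categories *)

Section Equivalence.

Lemma nat_iso_faithful (C D : category) (F : functor C D) (G : functor D C)
    (eta : nat_iso (comp_functor G F) (id_functor C)) (A B : C)
    (u v : hom A B) : fmap F u = fmap F v -> u = v.
Proof.
move=> uv; rewrite -[u]compm1 -[v]compm1 -(iso_fromK eta A) !compmA.
by rewrite -!(iso_natural eta) /= uv.
Qed.

(** The preimage is [k] under G conjugated by [eta]. Naturality gives G F u = G k, and G is faithful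
    because of [eps]. *)
Lemma nat_iso_full (C D : category) (F : functor C D) (G : functor D C)
    (eta : nat_iso (comp_functor G F) (id_functor C))
    (eps : nat_iso (comp_functor F G) (id_functor D)) (A B : C)
    (k : hom (F A) (F B)) : exists u : hom A B, fmap F u = k.
Proof.
pose u := compm (compm (iso_to eta B) (fmap G k)) (iso_from eta A).
exists u; apply: (nat_iso_faithful eps).
have eq_u : compm (iso_to eta B) (fmap G (fmap F u)) =
    compm (iso_to eta B) (fmap G k).
  have /= -> := iso_natural eta u.
  by rewrite /u -!compmA (iso_toK eta A) compm1.
rewrite -[LHS]comp1m -[RHS]comp1m -(iso_toK eta B) -!compmA.
by rewrite eq_u.
Qed.

Definition jointly_epi (C : category) (A : C) (J : Type) (X : J -> C)
    (h : forall j, hom (X j) A) : Prop :=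
  forall Z (u v : hom A Z), (forall j, compm u (h j) = compm v (h j)) -> u = v.

(** This combines projectivity with indecomposability, since a single member of the family must
    split. It speaks of arrows only, which makes it invariant under equivalence. *)
Definition cover_splits (C : category) (A : C) : Prop :=
  forall (J : Type) (X : J -> C) (h : forall j, hom (X j) A),
  jointly_epi h -> exists j (s : hom A (X j)), compm (h j) s = idm A.

Lemma cover_splits_equiv (C D : category) (F : functor C D) (G : functor D C)
    (eta : nat_iso (comp_functor G F) (id_functor C))
    (eps : nat_iso (comp_functor F G) (id_functor D)) (A : C) :
  cover_splits A -> cover_splits (F A).
Proof.
move=> splitA J X h epi_h.
pose h' j := compm (iso_to eta A) (fmap G (h j)).
have epi_h' : jointly_epi h'.
  move=> Z u v uv; apply: (nat_iso_faithful eta); apply: epi_h => j.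
  apply: (nat_iso_faithful eps); rewrite !fmapM.
  have := uv j; rewrite /h' !compmA.
  have /= <- := iso_natural eta u; have /= <- := iso_natural eta v.
  move/(congr1 (compm (iso_from eta Z))).
  by rewrite -!compmA !(compmA (iso_from eta Z)) (iso_toK eta Z) !comp1m.
have [j [s hs]] := splitA _ _ _ epi_h'; exists j.
(* The section is F s followed by [eps]; the factor F(eta_A) eps^-1 on the right is an automorphism
   of F A that compensates for [eta] and [eps] being unrelated. *)
exists (compm (compm (iso_to eps (X j)) (fmap F s))
  (compm (fmap F (iso_to eta A)) (iso_from eps (F A)))).
have /= nat_h := iso_natural eps (h j).
rewrite !compmA -nat_h -(compmA (iso_to eps _)) -fmapM.
have -> : compm (fmap G (h j)) s = iso_from eta A.
  rewrite -[LHS]comp1m -(iso_toK eta A) -!compmA (compmA (iso_to eta A)).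
  by rewrite -/(h' j) hs compm1.
rewrite -(compmA (iso_to eps _)) -fmapM (iso_toK eta A) fmap1 compm1.
exact: (iso_fromK eps (F A)).
Qed.

End Equivalence.

(** * Principal acts *)

Definition idem (S : invSemigroupType) : Type := {e : S | idempotent_elt e}.

Record uiso (S : semigroupType) (X Y : unitary_set S) := UIso {
  uto : uhom X Y;
  ufrom : uhom Y X;
  utoK : uhom_comp ufrom uto = uhom_id X;
  ufromK : uhom_comp uto ufrom = uhom_id Y
}.

Section Principal.
Variable S : invSemigroupType.
Implicit Types (e f g : idem S) (s t : S) (X : unitary_set S).

(** This is the left ideal S e. *)
Definition pcar e : Type := {x : S | x * sval e = x}.

Lemma pcar_ext e (x y : pcar e) : sval x = sval y -> x = y.
Proof.
case: x y => [x xP] [y yP] /= xy; subst y.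
by congr exist; apply: Prop_irrelevance.
Qed.

Lemma pact_subproof e s (x : pcar e) : s * sval x * sval e = s * sval x.
Proof. by rewrite -mulgA (svalP x). Qed.

Definition pact e s (x : pcar e) : pcar e := exist _ _ (pact_subproof s x).

Lemma pactM e s t (x : pcar e) : pact (s * t) x = pact s (pact t x).
Proof. by apply: pcar_ext; rewrite /= mulgA. Qed.

Lemma pact_unitary e (x : pcar e) : exists s y, pact s y = x.
Proof.
by exists (sval x * sinv (sval x)), x; apply: pcar_ext; rewrite /= mulsVs.
Qed.

Definition principal e : unitary_set S :=
  UnitarySet (@pactM e) (@pact_unitary e).

Definition gen e : principal e := exist (fun x => x * sval e = x) _ (svalP e).

Lemma act_gen e (x : principal e) : act (sval x) (gen e) = x.
Proof. by apply: pcar_ext; rewrite /= (svalP x). Qed.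

Lemma principal_hom_ext e X (h k : uhom (principal e) X) :
  h (gen e) = k (gen e) -> h = k.
Proof.
by move=> hk; apply: uhom_ext => x; rewrite -(act_gen x) !uhomE hk.
Qed.

Lemma hom_to_subproof e X (x : X) s (y : principal e) :
  act (sval (act s y)) x = act s (act (sval y) x).
Proof. by rewrite /= actM. Qed.

Definition hom_to e X (x : X) : uhom (principal e) X :=
  UHom (hom_to_subproof x).

(** A homomorphism S e -> S f is right multiplication by its value at the generator, which lies in e
    S f; composition therefore becomes the product in reverse order. *)
Definition hom_val e f (h : uhom (principal e) (principal f)) : S :=
  sval (h (gen e)).

Lemma hom_val_inj e f : injective (@hom_val e f).
Proof. by move=> h k hk; apply/principal_hom_ext/pcar_ext. Qed.

Lemma hom_valE e f (h : uhom (principal e) (principal f)) x :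
  sval (h x) = sval x * hom_val h.
Proof. by rewrite -{1}(act_gen x) uhomE. Qed.

Lemma hom_val_l e f (h : uhom (principal e) (principal f)) :
  sval e * hom_val h = hom_val h.
Proof. by rewrite -[LHS](hom_valE h (gen e)). Qed.

Lemma hom_val_r e f (h : uhom (principal e) (principal f)) :
  hom_val h * sval f = hom_val h.
Proof. exact: svalP (h (gen e)). Qed.

Lemma hom_val_comp e f g (h : uhom (principal f) (principal g))
    (k : uhom (principal e) (principal f)) :
  hom_val (uhom_comp h k) = hom_val k * hom_val h.
Proof. by rewrite -(hom_valE h). Qed.

Lemma hom_val_id e : hom_val (uhom_id (principal e)) = sval e.
Proof. by []. Qed.

Definition rmul e f s : uhom (principal e) (principal f) :=
  hom_to e (act (sval e * s) (gen f)).

Lemma hom_val_rmul e f s : hom_val (rmul e f s) = sval e * s * sval f.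
Proof. by rewrite /hom_val /= !mulgA (svalP e). Qed.

Lemma rmul_ext e f s t :
  sval e * s * sval f = sval e * t * sval f -> rmul e f s = rmul e f t.
Proof. by move=> st; apply: hom_val_inj; rewrite !hom_val_rmul. Qed.

Lemma rmul_inj e f s t :
  rmul e f s = rmul e f t -> sval e * s * sval f = sval e * t * sval f.
Proof. by move=> /(congr1 (@hom_val e f)); rewrite !hom_val_rmul. Qed.

Lemma rmul_hom_val e f (h : uhom (principal e) (principal f)) :
  rmul e f (hom_val h) = h.
Proof. by apply: hom_val_inj; rewrite hom_val_rmul hom_val_l hom_val_r. Qed.

Lemma rmul_comp e f g s t :
  uhom_comp (rmul f g t) (rmul e f s) = rmul e g (s * sval f * t).
Proof.
apply: hom_val_inj; rewrite hom_val_comp !hom_val_rmul !mulgA.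
by rewrite mulKidem //; apply: svalP.
Qed.

(* The characteristic map of a subset U of X into the unital functions
   S -> Prop plays the role of a subobject classifier: it agrees with the
   constantly true map on a jointly epi family with union of images U. *)
Section Characteristic.
Variables (X : unitary_set S) (U : X -> Prop).

Definition prop_set : unitary_set S :=
  @unital_set S S Prop mul (@mulgA S) (fun=> True) (fun _ _ _ => I).

Lemma char_subproof (x : X) :
  True /\ exists s, forall t, U (act (t * s) x) = U (act t x).
Proof.
split=> //; have [e _ ex] := unitary_idem x; exists e => t.
by rewrite actM ex.
Qed.

Definition char_fun (x : X) : prop_set := exist _ _ (char_subproof x).

Lemma char_funE s x : char_fun (act s x) = act s (char_fun x).
Proof. by apply: unital_ext => t /=; rewrite actM. Qed.

Definition char_map : uhom X prop_set := UHom char_funE.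

End Characteristic.

Lemma jointly_epi_surj (A : Smod S) (J : Type) (X : J -> Smod S)
    (h : forall j, hom (X j) A) : jointly_epi h ->
  forall a : uset A, exists j (x : uset (X j)), uhom_fun (h j) x = a.
Proof.
move=> epi_h a; pose U a := exists j (x : uset (X j)), uhom_fun (h j) x = a.
have eqU : @char_map A U = @char_map A (fun=> True).
  apply: epi_h => j; apply: uhom_ext => x; apply: unital_ext => t /=.
  by apply/propext; split=> // _; exists j, (act t x); rewrite uhomE.
(* The characteristic map of U sends a to the function t |-> U(t a). As S may have no identity, it
   is evaluated at an idempotent fixing [a]. *)
have [e _ ea] := unitary_idem a; rewrite -/(U a) -ea.
by have /= -> := congr1 (fun k : uhom A prop_set => sval (k a) e) eqU.
Qed.

(** Some h_j x is the generator e, and y |-> y x is then a section of h_j. *)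
Lemma principal_cover_splits e : @cover_splits (Smod S) (principal e).
Proof.
move=> J X h /jointly_epi_surj/(_ (gen e))[j [x hx]].
exists j, (hom_to e x); apply: principal_hom_ext => /=.
by rewrite uhomE hx; apply: pcar_ext; apply: svalP e.
Qed.

(** The idempotent endomorphism s h of S e is right multiplication by an idempotent c, and s
    identifies X with its image S c. *)
Lemma retract_principal e X (h : uhom (principal e) X)
    (s : uhom X (principal e)) :
  uhom_comp h s = uhom_id X -> exists f, inhabited (uiso X (principal f)).
Proof.
move=> hs; have hsE x : h (s x) = x := congr1 (fun k : uhom X X => k x) hs.
pose c := hom_val (uhom_comp s h).
have cc : c * c = c.
  by rewrite -hom_val_comp; congr hom_val; apply: uhom_ext => x /=; rewrite hsE.
have sc x : sval (s x) * c = sval (s x).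
  by rewrite -(hom_valE (uhom_comp s h)) /= hsE.
pose f : idem S := exist _ c cc; exists f.
pose sf x : principal f := exist _ _ (sc x).
have sfE t x : sf (act t x) = act t (sf x).
  by apply: pcar_ext; rewrite /= uhomE.
constructor; apply: (@UIso _ _ _ (UHom sfE) (hom_to f (h (gen e)))).
  by apply: uhom_ext => x /=; rewrite -uhomE act_gen hsE.
apply: uhom_ext => y; apply: pcar_ext => /=; rewrite uhomE.
exact: (svalP y).
Qed.

Lemma cover_splits_principal (A : Smod S) :
  cover_splits A -> exists f, inhabited (uiso A (principal f)).
Proof.
move=> splitA.
have unit_of (a : uset A) : exists e : idem S, act (sval e) a = a.
  by have [e ee ea] := unitary_idem a; exists (exist _ e ee).
pose e a := sval (cid (unit_of a)).
have [|a [s hs]] := splitA (uset A) (fun a => principal (e a))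
    (fun a => hom_to (e a) a).
  move=> Z u v uv; apply: uhom_ext => a.
  have := congr1 (fun k : uhom (principal (e a)) Z => k (gen (e a))) (uv a).
  by rewrite /= (svalP (cid (unit_of a))).
exact: retract_principal hs.
Qed.

End Principal.

(** * Recovering the semigroup from its corners *)

Section CornerSystem.
Variables (S T : invSemigroupType) (I : Type).
(** [Phi i j] accepts any t but sees only e_i t e_j, and it maps the corner e_i T e_j bijectively
    onto the corner of S cut out by the idempotents Phi_ii(e_i) and Phi_jj(e_j). *)
Variables (e : I -> T) (Phi : I -> I -> T -> S).
Hypothesis ee : forall i, idempotent_elt (e i).
Hypothesis PhiM : forall i j k t u,
  Phi i j t * Phi j k u = Phi i k (t * e j * u).
Hypothesis PhiP : forall i j t u,
  Phi i j t = Phi i j u <-> e i * t * e j = e i * u * e j.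
Hypothesis Phi_surj : forall i j s,
  exists t, Phi i j t = Phi i i (e i) * s * Phi j j (e j).
Hypothesis e_cover : forall f : T, idempotent_elt f -> exists i, e i = f.
Hypothesis Phi_cover : forall f : S, idempotent_elt f ->
  exists i, Phi i i (e i) = f.

Definition corner_fun i j : S := Phi i j (e i * e j).

Lemma Phi_l i j t : Phi i j (e i * t) = Phi i j t.
Proof. by apply/PhiP; rewrite !mulgA ee. Qed.

Lemma Phi_r i j t : Phi i j (t * e j) = Phi i j t.
Proof. by apply/PhiP; rewrite !mulgA (mulKidem _ (ee j)). Qed.

Lemma corner_funE i : corner_fun i i = Phi i i (e i).
Proof. by rewrite /corner_fun ee. Qed.

Lemma corner_fun_mull k i j t :
  corner_fun k i * Phi i j t = Phi k j (e i * t).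
Proof.
by rewrite PhiM (mulKidem _ (ee i)) -mulgA Phi_l.
Qed.

Lemma corner_fun_mulr i j l t :
  Phi i j t * corner_fun j l = Phi i l (t * e j).
Proof. by rewrite PhiM !mulgA (mulKidem _ (ee j)) Phi_r. Qed.

Lemma corner_fun_McAlister : McAlister corner_fun.
Proof.
split.
- by move=> i; rewrite /idempotent_elt {2}/corner_fun corner_fun_mull mulgA ee.
- move=> i j; rewrite {2}/corner_fun corner_fun_mull Phi_l corner_fun_mulr.
  by rewrite (mulKidem _ (ee j)).
(* Exchanging i and j in this one equation yields the other half of the inverse property. *)
- suff inv i j : corner_fun i j * corner_fun j i * corner_fun i j =
      corner_fun i j by move=> i j; apply/esym/sinv_uniq.
  rewrite {2}/corner_fun corner_fun_mull {2}/corner_fun PhiM.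
  apply/PhiP; rewrite !mulgA !(mulKidem _ (ee _)).
  by rewrite (mulIidem _ (ee j) (ee i)) !(mulKidem _ (ee _)) ee.
(* Both p_ij p_jk and p_ik Phi_kk(e_j) are the image under Phi_ik of e_i e_j e_k. *)
- move=> i j k; exists (Phi k k (e j)); split.
    rewrite /idempotent_elt PhiM; apply/PhiP; rewrite !mulgA.
    by rewrite !(mulIidem (e k) (ee j) (ee k), ee, mulKidem _ (ee _)).
  rewrite {2}/corner_fun corner_fun_mull {1}/corner_fun PhiM.
  apply/PhiP; rewrite !mulgA.
  by rewrite !(mulIidem (e i) (ee k) (ee j), ee, mulKidem _ (ee _)).
- move=> f /Phi_cover[i fE]; exists i; rewrite corner_funE fE.
  exact: le_refl.
Qed.

Let pM := corner_fun_McAlister.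

Lemma corner_coverT t : exists i j, e i * t = t /\ t * e j = t.
Proof.
have [i ei] := e_cover (idem_mulsV t); have [j ej] := e_cover (idem_mulVs t).
by exists i, j; rewrite ei ej mulgA mulsVs.
Qed.

Lemma imx_corner i j t k l : e i * t = t -> t * e j = t ->
  imx (elt pM i (Phi i j t) j) k l = Phi k l t.
Proof.
by move=> it tj; rewrite imx_elt corner_fun_mull corner_fun_mulr it tj.
Qed.

Lemma corner_elt t : exists a : IM corner_fun,
  forall k l, imx a k l = Phi k l t.
Proof.
have [i [j [it tj]]] := corner_coverT t.
by exists (elt pM i (Phi i j t) j) => k l; apply: imx_corner.
Qed.

Definition corner_iso t : IM corner_fun := sval (cid (corner_elt t)).

Lemma imx_corner_iso t k l : imx (corner_iso t) k l = Phi k l t.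
Proof. exact: svalP (cid (corner_elt t)) k l. Qed.

Lemma corner_isoM : {morph corner_iso : t u / t * u}.
Proof.
move=> t u; apply: (imx_inj pM) => k l; rewrite imx_corner_iso.
have [i [j [iu uj]]] := corner_coverT u.
have -> : corner_iso u = elt pM i (Phi i j u) j.
  by apply: (imx_inj pM) => k' l'; rewrite imx_corner_iso imx_corner.
rewrite imx_mulr imx_corner_iso -mulgA corner_fun_mulr PhiM uj.
by rewrite -mulgA iu.
Qed.

(** Equal matrices give t = e_i u e_j and u = e_k t e_l for indices whose idempotents fix t and u
    respectively. Since idempotents commute, u = e_i e_k u e_l e_j = e_i u e_j = t. *)
Lemma corner_iso_inj : injective corner_iso.
Proof.
move=> t u tu.
have cut i j : e i * t * e j = e i * u * e j.
  by apply/PhiP; rewrite -!imx_corner_iso tu.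
have [i [j [it tj]]] := corner_coverT t.
have [k [l [ku ul]]] := corner_coverT u.
have tE : e i * u * e j = t by rewrite -cut it tj.
have uE : e k * t * e l = u by rewrite cut ku ul.
rewrite -uE -tE !mulgA (idemC (ee k) (ee i)) (mulIidem _ (ee j) (ee l)).
by rewrite -(mulgA (e i) (e k)) ku -(mulgA (e i) u (e l)) ul.
Qed.

Lemma corner_iso_surj a : exists t, corner_iso t = a.
Proof.
have [i [s [j ->]]] := elt_surj pM a; have [t tE] := Phi_surj i j s.
exists (e i * t * e j); apply: (imx_inj pM) => k l.
rewrite imx_corner_iso imx_elt.
(* Cutting s down to p_ii s p_jj leaves the matrix unchanged and brings it into the range of
   Phi_ij. *)
have -> : corner_fun k i * s * corner_fun j l =
    corner_fun k i * Phi i j t * corner_fun j l.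
  rewrite tE !mulgA -!corner_funE (mcA_r pM) -!mulgA; congr (_ * (_ * _)).
  by rewrite (mcA_l pM).
by rewrite corner_fun_mull corner_fun_mulr.
Qed.

HB.instance Definition _ :=
  isMultiplicative.Build T (IM corner_fun) corner_iso corner_isoM.

Lemma corner_semigroup_iso : semigroup_iso T (IM corner_fun).
Proof.
exists (corner_iso : {multiplicative T -> IM corner_fun}).
exists (fun a => sval (cid (corner_iso_surj a))) => [t|a].
  by apply: corner_iso_inj; apply: svalP (cid (corner_iso_surj _)).
exact: svalP (cid (corner_iso_surj a)).
Qed.

End CornerSystem.

(** * Corners transported along an equivalence *)

Section FromEquivalence.
Variables (S T : invSemigroupType).
Variables (F : functor (Smod T) (Smod S)) (G : functor (Smod S) (Smod T)).
Variable eta : nat_iso (comp_functor G F) (id_functor (Smod T)).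
Variable eps : nat_iso (comp_functor F G) (id_functor (Smod S)).

(* MF5 requires every idempotent of S to lie below some p_{i,i}, so the index
   set contains all triples, not a choice of one f for each e. *)
Record corner_index := CornerIndex {
  src : idem T;
  tgt : idem S;
  cuiso : uiso (F (principal src)) (principal tgt)
}.

Definition transport (i j : corner_index)
    (h : uhom (principal (src i)) (principal (src j))) :
    uhom (principal (tgt i)) (principal (tgt j)) :=
  uhom_comp (uto (cuiso j))
    (uhom_comp (fmap F (h : hom (c := Smod T) _ _)) (ufrom (cuiso i))).

Lemma transport_id i : transport (uhom_id (principal (src i))) = uhom_id _.
Proof.
have /= F1 := fmap1 F (principal (src i)).
by rewrite /transport F1 uhom_comp1m ufromK.
Qed.

Lemma transport_comp i j k
    (h : uhom (principal (src j)) (principal (src k)))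
    (g : uhom (principal (src i)) (principal (src j))) :
  transport (uhom_comp h g) = uhom_comp (transport h) (transport g).
Proof.
have /= FM := fmapM F (h : hom (c := Smod T) _ _) (g : hom (c := Smod T) _ _).
rewrite /transport FM -!uhom_compA; do 2 congr uhom_comp.
by rewrite !uhom_compA utoK uhom_comp1m.
Qed.

Lemma transport_inj i j : injective (@transport i j).
Proof.
move=> g h gh; apply: (nat_iso_faithful eta).
have := congr1 (fun k => uhom_comp (ufrom (cuiso j))
  (uhom_comp k (uto (cuiso i)))) gh.
by rewrite /transport -!uhom_compA !utoK !uhom_compm1 !uhom_compA !utoK
  !uhom_comp1m.
Qed.

Lemma transport_surj i j (k : uhom (principal (tgt i)) (principal (tgt j))) :
  exists h, @transport i j h = k.
Proof.
have [h Fh] := nat_iso_full eta eps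
  (uhom_comp (ufrom (cuiso j)) (uhom_comp k (uto (cuiso i)))
     : hom (c := Smod S) (F (principal (src i))) (F (principal (src j)))).
exists h; rewrite /transport Fh -!uhom_compA ufromK uhom_compm1 uhom_compA.
by rewrite ufromK uhom_comp1m.
Qed.

(** This is the [Phi] of the corner system: e_i t e_j is read as a map T e_i -> T e_j, transported
    by F, and read back in f_i S f_j. Both readings reverse composition, so products keep their
    order. *)
Definition corner_map i j (t : T) : S :=
  hom_val (@transport i j (rmul (src i) (src j) t)).

Lemma corner_mapM i j k t u :
  corner_map i j t * corner_map j k u =
  corner_map i k (t * sval (src j) * u).
Proof. by rewrite /corner_map -hom_val_comp -transport_comp rmul_comp. Qed.

Lemma corner_mapP i j t u : corner_map i j t = corner_map i j u <->
  sval (src i) * t * sval (src j) = sval (src i) * u * sval (src j).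
Proof.
split=> [/hom_val_inj/transport_inj/rmul_inj //|].
by rewrite /corner_map => /rmul_ext ->.
Qed.

Lemma corner_map_id i : corner_map i i (sval (src i)) = sval (tgt i).
Proof.
rewrite /corner_map -[X in rmul _ _ X](hom_val_id (src i)) rmul_hom_val.
by rewrite transport_id.
Qed.

Lemma corner_map_surj i j s : exists t, corner_map i j t =
  corner_map i i (sval (src i)) * s * corner_map j j (sval (src j)).
Proof.
have [h hE] := transport_surj (rmul (tgt i) (tgt j) s).
exists (hom_val h); rewrite /corner_map rmul_hom_val hE hom_val_rmul.
by rewrite -!/(corner_map _ _ _) !corner_map_id.
Qed.

Lemma corner_index_src (e : T) : idempotent_elt e -> exists i, sval (src i) = e.
Proof.
move=> ee; pose e' : idem T := exist _ e ee.
have [f [fF]] := cover_splits_principal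
  (cover_splits_equiv eta eps (@principal_cover_splits T e')).
by exists (CornerIndex fF).
Qed.

(** By the symmetric argument G(Sf) is isomorphic to some Te, whence F(Te) is isomorphic to F(G(Sf))
    and so to Sf. *)
Lemma corner_index_tgt (f : S) :
  idempotent_elt f -> exists i, corner_map i i (sval (src i)) = f.
Proof.
move=> ff; pose f' : idem S := exist _ f ff.
have [e [eG]] := cover_splits_principal
  (cover_splits_equiv eps eta (@principal_cover_splits S f')).
pose up : hom (c := Smod T) _ _ := uto eG.
pose down : hom (c := Smod T) _ _ := ufrom eG.
have FK := congr1 (@fmap _ _ F _ _) (ufromK eG : compm up down = idm _).
have FK' := congr1 (@fmap _ _ F _ _) (utoK eG : compm down up = idm _).
rewrite fmapM fmap1 /= in FK; rewrite fmapM fmap1 /= in FK'.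
have /= toK := iso_toK eps (principal f').
have /= fromK := iso_fromK eps (principal f').
have Fe : uiso (F (principal e)) (principal f').
  exists (uhom_comp (iso_to eps (principal f')) (fmap F down))
         (uhom_comp (fmap F up) (iso_from eps (principal f'))).
    by rewrite -uhom_compA [X in uhom_comp _ X]uhom_compA toK uhom_comp1m.
  by rewrite -uhom_compA [X in uhom_comp _ X]uhom_compA FK' uhom_comp1m.
by exists (CornerIndex Fe); rewrite corner_map_id.
Qed.

Lemma equivalence_rees : exists (I : Type) (p : I -> I -> S),
  McAlister p /\ semigroup_iso T (IM p).
Proof.
have ee (i : corner_index) : idempotent_elt (sval (src i)) := svalP (src i).
exists corner_index; eexists; split.
  exact: (corner_fun_McAlister ee corner_mapM corner_mapP corner_index_tgt).
exact: (corner_semigroup_iso ee corner_mapM corner_mapP corner_map_surj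
  corner_index_src corner_index_tgt).
Qed.

End FromEquivalence.

Theorem theorem3p5 (S : invSemigroupType) :
  (forall (I : Type) (p : I -> I -> S),
     McAlister p -> morita_equivalent (IM p) S) /\
  (forall T : invSemigroupType, morita_equivalent T S ->
     exists (I : Type) (p : I -> I -> S), McAlister p /\ semigroup_iso T (IM p)).
Proof.
split=> [I p|T [F [G [[eta] [eps]]]]]; first exact: IM_morita.
exact: equivalence_rees eta eps.
Qed.
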